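(* Let $(E,\mathcal{V})$ be a Steiner system $S(5,8,24)$, and let $e,f\in E$ be distinct elements. Let $\mathcal{C}$ be the collection of all six-element subsets $C\subset E$ for which there exists a block $V\in\mathcal{V}$ with $|V\cap\{e,f\}|=1$ and $C\subset V$, and let $\mathcal{B}$ be the collection of all six-element subsets of $E$ that are not in $\mathcal{C}$. Then $M=(E,\mathcal{B})$ is a paving matroid of rank six on a ground set of size $24$, and the events $e\in X$ and $f\in X$ are positively correlated when $X\in\mathcal{B}$ is chosen uniformly at random, i.e. $\Pr(e\in X\mid f\in X)>\Pr(e\in X)$. In particular, $M$ is not balanced, and so there exists a paving matroid that is not balanced.
   Context: A Steiner system $S(5,8,24)$ is a pair $(E,\mathcal{V})$ with $|E|=24$ and $\mathcal{V}\subset 2^E$ a collection of blocks, each of size eight, such that each five-element subset of $E$ is contained in a unique block; such a system is known to exist. A matroid $M=(E,\mathcal{B})$ is given by a finite ground set $E$ and its collection of bases $\mathcal{B}\subseteq 2^E$; all bases have the same size $r$, the rank of $M$. A subset of $E$ is independent if it is contained in some basis. A loop is an element contained in no basis; a coloop is an element contained in every basis. $M$ of rank $r$ is paving if all $(r-1)$-element subsets of $E$ are independent. If $g\in E$ is neither a loop nor a coloop, the deletion $M\setminus g$ has ground set $E\setminus\{g\}$ and bases $\{X\subseteq E\setminus\{g\}: X\in\mathcal{B}\}$; the contraction $M/g$ has ground set $E\setminus\{g\}$ and bases $\{X\subseteq E\setminus\{g\}: X\cup\{g\}\in\mathcal{B}\}$. A minor of $M$ is any matroid obtained from $M$ by a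 (possibly empty) series of deletions and contractions. A matroid has the negative correlation property if $\Pr(a\in X\mid b\in X)\le\Pr(a\in X)$ for all distinct ground set elements $a,b$ with $b$ not a loop, where $X$ is a uniformly random basis. A matroid is balanced if all its minors (including itself) have the negative correlation property. *)

(* Defs.v *)
From HB Require Import structures.
From mathcomp Require Import all_boot all_order all_algebra.

Set Implicit Arguments.
Unset Strict Implicit.
Unset Printing Implicit Defensive.

Import Order.TTheory GRing.Theory Num.Theory.

Definition steiner_system (T : finType) (t k n : nat)
    (E : {set T}) (V : {set {set T}}) : Prop :=
  [/\ #|E| = n,
      forall W, W \in V -> W \subset E /\ #|W| = k
    & forall A : {set T}, A \subset E -> #|A| = t ->
        exists! W : {set T}, W \in V /\ A \subset W].

(* The ground set is a subset of an ambient finite type, so that deletion and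
   contraction, which shrink the ground set, stay within the same type. *)
Record basis_system (T : finType) := BasisSystem {
  ground : {set T};
  bases : {set {set T}}
}.

Section Matroids.
Variable T : finType.
Implicit Types (M N : basis_system T) (A B X : {set T}) (a b g : T).

Definition is_matroid M : Prop :=
  [/\ forall B, B \in bases M -> B \subset ground M,
      exists B, B \in bases M
    & forall B1 B2, B1 \in bases M -> B2 \in bases M ->
        forall x, x \in B1 :\: B2 ->
        exists2 y, y \in B2 :\: B1 & y |: (B1 :\ x) \in bases M].

(* In a matroid all bases have the same size, by the exchange axiom; the
   maximum is that common size. *)
Definition rank M : nat := \max_(B in bases M) #|B|.

Definition independent M A : Prop :=
  exists2 B, B \in bases M & A \subset B.

Definition loop M g : Prop :=
  g \in ground M /\ forall B, B \in bases M -> g \notin B.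

Definition coloop M g : Prop :=
  g \in ground M /\ forall B, B \in bases M -> g \in B.

(* #|A|.+1 = rank M, rather than #|A| = (rank M).-1, avoids truncated
   subtraction at rank zero. *)
Definition paving M : Prop :=
  forall A, A \subset ground M -> #|A|.+1 = rank M -> independent M A.

Definition deletion M g : basis_system T :=
  BasisSystem (ground M :\ g)
    [set X : {set T} | (X \subset ground M :\ g) && (X \in bases M)].

Definition contraction M g : basis_system T :=
  BasisSystem (ground M :\ g)
    [set X : {set T} | (X \subset ground M :\ g) && (g |: X \in bases M)].

Inductive minor M : basis_system T -> Prop :=
| minor_refl : minor M M
| minor_deletion N g :
    minor M N -> g \in ground N -> ~ loop N g -> ~ coloop N g ->
    minor M (deletion N g)
| minor_contraction N g :
    minor M N -> g \in ground N -> ~ loop N g -> ~ coloop N g ->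
    minor M (contraction N g).

Local Open Scope ring_scope.

(* Probability of an event for a uniformly random basis of M. *)
Definition Pr M (P : pred {set T}) : rat :=
  #|[set X in bases M | P X]|%:R / #|bases M|%:R.

(* Only meaningful when Pr M Q != 0; otherwise it takes the junk value 0. *)
Definition condPr M (P Q : pred {set T}) : rat :=
  Pr M (fun X => P X && Q X) / Pr M Q.

Definition negative_correlation M : Prop :=
  forall a b, a \in ground M -> b \in ground M -> a != b -> ~ loop M b ->
  condPr M (fun X => a \in X) (fun X => b \in X) <= Pr M (fun X => a \in X).

Definition balanced M : Prop :=
  forall N, minor M N -> negative_correlation N.

End Matroids.

Definition split_block_hexads (T : finType) (E : {set T}) (V : {set {set T}})
    (e f : T) : {set {set T}} :=
  [set C : {set T} | [&& C \subset E, #|C| == 6 &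
     [exists W in V, (#|W :&: [set e; f]| == 1) && (C \subset W)]]].

Definition steiner_basis_system (T : finType) (E : {set T})
    (V : {set {set T}}) (e f : T) : basis_system T :=
  BasisSystem E
    [set X : {set T} | [&& X \subset E, #|X| == 6 &
       X \notin split_block_hexads E V e f]].

(* Main.v *)
Require Import Defs.
From HB Require Import structures.
From Stdlib Require Import NArith.
From mathcomp Require Import all_boot all_order all_algebra.
From mathcomp Require Import zify.

Set Implicit Arguments.
Unset Strict Implicit.
Unset Printing Implicit Defensive.

Import Order.TTheory GRing.Theory Num.Theory.

(** Call a block split if it contains exactly one of [e] and [f]. Two blocks
    share at most four points, so a hexad lies in at most one block; if no
    exchange of [x] in [B1] worked, the block through [B1 :\ x] would be split
    and contain [B2].
    Every point lies in 253 blocks and every pair in 77, so there are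
    2 * (253 - 77) = 352 split blocks, 176 through each of [e] and [f] and none
    through both. Counting the hexads outside the split blocks gives
    134596 - 352 * 28 = 77 * 1620 bases, of which 33649 - 176 * 21 = 77 * 389
    contain [e], as many contain [f], and 7315 = 77 * 95 contain both; and
    389 * 389 < 95 * 1620.
    A Steiner system exists: the words of weight 8 of the extended binary Golay
    code form one, since by linearity two of them meet in at most four points,
    and 759 * C(8, 5) = C(24, 5). *)

(** * Double counting of subsets *)

(** Adjoining [S] is a bijection from the subsets of [W :\: S] of size [k - #|S|] onto the sets
    counted here. *)
Lemma card_draws_between (T : finType) (S W : {set T}) (k : nat) :
  S \subset W -> #|S| <= k ->
  #|[set X : {set T} | [&& S \subset X, X \subset W & #|X| == k]]|
    = 'C(#|W| - #|S|, k - #|S|).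
Proof.
move=> sSW leSk.
rewrite -[#|W| - _](cardsDS sSW) -cards_draws.
have inj : {in [set Y : {set T} | Y \subset W :\: S & #|Y| == k - #|S|] &,
            injective (fun Y => S :|: Y)}.
  move=> Y Z; rewrite !inE !subsetD => /andP[/andP[_ dY] _] /andP[/andP[_ dZ] _].
  move=> /(congr1 (fun A => A :\: S)).
  by rewrite !setDUl !setDv !set0U !(setDidPl _).
rewrite -(card_in_imset inj); apply: eq_card => X; apply/idP/imsetP.
- rewrite inE => /and3P[sSX sXW /eqP cX]; exists (X :\: S).
    by rewrite inE setSD //= cardsDS // cX.
  by rewrite setDE setUIr setUCr setIT; apply/esym/setUidPr.
- move=> [Y]; rewrite !inE subsetD => /andP[/andP[sYW dYS] /eqP cY] ->.
  rewrite subsetUl subUset sSW sYW /= cardsU cY.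
  rewrite disjoint_sym in dYS.
  by rewrite (disjoint_setI0 dYS) cards0 subn0 subnKC.
Qed.

(** Exchanging the two summations counts each [A] once, at the only [W] above it. *)
Lemma double_count (T : finType) (P Q : {set {set T}}) :
  (forall A, A \in P -> exists! W, W \in Q /\ A \subset W) ->
  #|P| = \sum_(W in Q) #|[set A in P | A \subset W]|.
Proof.
move=> PQ; rewrite -sum1_card.
under [RHS]eq_bigr => W _.
  rewrite -sum1_card; under eq_bigl => A do rewrite inE.
  over.
rewrite (exchange_big_dep (mem P)) /=; last by move=> W A _ /andP[].
apply: eq_bigr => A PA.
have [W [[QW sAW] uW]] := PQ A PA.
rewrite (bigD1 W) /=; last by rewrite QW PA sAW.
rewrite big1 // => W' /andP[/and3P[QW' _ sAW'] /eqP[]].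
by apply/esym/uW.
Qed.

(** * Uniqueness and degrees of blocks in a Steiner system *)

Section Steiner.
Variables (T : finType) (t k n : nat) (E : {set T}) (V : {set {set T}}).
Hypothesis stV : steiner_system t k n E V.

Lemma steiner_subset (W : {set T}) : W \in V -> W \subset E.
Proof. by case: stV => _ h _ /h[]. Qed.

Lemma steiner_card (W : {set T}) : W \in V -> #|W| = k.
Proof. by case: stV => _ h _ /h[]. Qed.

(** A [t]-element subset of [A] already determines the block. This form applies to hexads when [t]
    is five. *)
Lemma steiner_unique (A W1 W2 : {set T}) : t <= #|A| ->
  W1 \in V -> W2 \in V -> A \subset W1 -> A \subset W2 -> W1 = W2.
Proof.
move=> tA V1 V2 A1 A2.
have : 0 < #|[set B : {set T} | B \subset A & #|B| == t]|.
  by rewrite cards_draws bin_gt0.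
case/card_gt0P => B; rewrite inE => /andP[sBA /eqP cB].
have sBE : B \subset E.
  exact: subset_trans (subset_trans sBA A1) (steiner_subset V1).
case: stV => _ _ /(_ B sBE cB)[W [_ u]].
by transitivity W; [apply/esym|]; apply: u; split=> //; apply: subset_trans sBA _.
Qed.

(** Count the [t]-sets between [S] and [E]: each lies in exactly one block, and that block contains
    [S]. *)
Lemma steiner_degree (S : {set T}) : S \subset E -> #|S| <= t ->
  #|[set W in V | S \subset W]| * 'C(k - #|S|, t - #|S|)
    = 'C(n - #|S|, t - #|S|).
Proof.
move=> sSE cS; have [cE _ exV] := stV.
rewrite -cE -(card_draws_between sSE cS).
rewrite [RHS](double_count (Q := [set W in V | S \subset W])); last first.
  move=> A; rewrite inE => /and3P[sSA sAE /eqP cA].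
  have [W [[VW sAW] u]] := exV A sAE cA.
  exists W; split; first by rewrite inE VW (subset_trans sSA).
  by move=> W'; rewrite inE => -[/andP[VW' _] sAW']; apply: u.
rewrite -sum_nat_const; apply: eq_bigr => W; rewrite inE => /andP[VW sSW].
rewrite -(steiner_card VW) -card_draws_between //; apply: eq_card => A.
rewrite !inE; case sAW: (A \subset W); rewrite ?andbF ?andbT //=.
by rewrite (subset_trans sAW (steiner_subset VW)).
Qed.

End Steiner.

Lemma setId_sub1 (T : finType) (Q : {set {set T}}) (x : T) :
  [set W in Q | [set x] \subset W] = [set W in Q | x \in W].
Proof. by apply/setP => W; rewrite !inE sub1set. Qed.

Lemma setId_sub2 (T : finType) (Q : {set {set T}}) (x y : T) :
  [set W in Q | [set x; y] \subset W]
    = [set W in Q | (x \in W) && (y \in W)].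
Proof. by apply/setP => W; rewrite !inE subUset !sub1set. Qed.

(** After cancelling [c] the claim reads x/n < y/x. With [n], [x], [y] proportional to the numbers
    of all bases, of those through one point and of those through both, this is positive
    correlation. *)
Lemma natr_ratio_lt (F : numFieldType) (c n x y : nat) :
  0 < c -> 0 < n -> 0 < x -> x * x < y * n ->
  ((c * x)%:R / (c * n)%:R
     < (c * y)%:R / (c * n)%:R / ((c * x)%:R / (c * n)%:R) :> F)%R.
Proof.
move=> c0 n0 x0 lt_xy.
have nz m : 0 < m -> (m%:R != 0 :> F)%R by rewrite pnatr_eq0 -lt0n.
have cancel_c m : ((c * m)%:R / (c * n)%:R = m%:R / n%:R :> F)%R.
  by rewrite !natrM -mulf_div divff ?nz // mul1r.
rewrite !cancel_c invf_div mulrA divfK ?nz //.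
by rewrite ltr_pdivrMr ?ltr0n // mulrAC ltr_pdivlMr ?ltr0n // -!natrM ltr_nat.
Qed.

(** * The paving matroid defined by the split blocks *)

Section SplitBlocks.
Variables (T : finType) (E : {set T}) (V : {set {set T}}) (e f : T).
Hypotheses (stV : steiner_system 5 8 24 E V).
Hypotheses (eE : e \in E) (fE : f \in E) (ef : e != f).

Definition split_blocks : {set {set T}} :=
  [set W in V | #|W :&: [set e; f]| == 1].

Lemma card_setI_pair (W : {set T}) :
  #|W :&: [set e; f]| = (e \in W) + (f \in W).
Proof.
rewrite -sum1_card (eq_bigl (fun x => (x \in [set e; f]) && (x \in W))).
  rewrite big_mkcondr /= big_setU1 ?inE //= big_set1.
  by case: (e \in W); case: (f \in W).
by move=> x; rewrite !inE andbC.
Qed.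

Let M := steiner_basis_system E V e f.

Lemma steiner_basesP (X : {set T}) :
  reflect [/\ X \subset E, #|X| = 6 &
              forall W, W \in split_blocks -> ~~ (X \subset W)]
          (X \in bases M).
Proof.
rewrite inE; apply: (iffP and3P) => -[sX cX h].
  split=> //; first exact/eqP.
  move=> W; rewrite inE => /andP[VW cW]; apply: contra h => sXW.
  rewrite inE sX cX /=; apply/existsP; exists W.
  by rewrite VW cW sXW.
split=> //; first exact/eqP.
rewrite inE sX cX /=; apply/existsPn => W; rewrite negb_and -implybE.
apply/implyP => VW; rewrite negb_and -implybE; apply/implyP => cW.
by apply: h; rewrite inE VW.
Qed.

(** Add to [A] a point outside the only block containing [A]; the resulting hexad lies in no block
    at all. *)
Lemma steiner_independent (A : {set T}) : A \subset E -> #|A| = 5 -> independent M A.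
Proof.
move=> sA cA; have [cE _ exV] := stV.
have [W [[VW sAW] u]] := exV A sA cA.
have : 0 < #|E :\: W|.
  by rewrite cardsDS ?(steiner_subset stV VW) // cE (steiner_card stV VW).
case/card_gt0P => y; rewrite inE => /andP[yW yE].
exists (y |: A); last exact: subsetUr.
have yA : y \notin A by apply: contra yW; apply/subsetP.
apply/steiner_basesP; split.
- by rewrite subUset sub1set yE.
- by rewrite cardsU1 yA cA.
- move=> W'; rewrite inE subUset sub1set => /andP[VW' _].
  by apply/negP=> /andP[yW' sAW']; move: yW; rewrite (u W') ?yW'.
Qed.

Lemma steiner_bases_neq0 : exists B, B \in bases M.
Proof.
have [cE _ _] := stV.
have : 0 < #|[set B : {set T} | B \subset E & #|B| == 5]|.
  by rewrite cards_draws cE.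
case/card_gt0P => A; rewrite inE => /andP[sA /eqP cA].
by have [B] := steiner_independent sA cA; exists B.
Qed.

Lemma steiner_is_matroid : is_matroid M.
Proof.
split; [by move=> B /steiner_basesP[] | exact: steiner_bases_neq0 |].
move=> B1 B2 /steiner_basesP[s1 c1 h1] /steiner_basesP[s2 c2 h2] x.
rewrite inE => /andP[xB2 xB1].
have cA : #|B1 :\ x| = 5 by move: c1; rewrite (cardsD1 x) xB1 => -[].
have sA : B1 :\ x \subset E by apply: subset_trans (subD1set _ _) s1.
have [_ _ /(_ _ sA cA) [W [[VW sAW] u]]] := stV.
have [/existsP[y /andP[yD yB]]|/existsPn nex] :=
  boolP [exists y, (y \in B2 :\: B1) && (y |: (B1 :\ x) \in bases M)].
  by exists y.
(* If no exchange works, every [B1 :\ x + y] lies in a split block; that block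
   is the one through the five points [B1 :\ x], so it contains [B2]. *)
have bad y : y \in B2 -> y \notin B1 -> (W \in split_blocks) /\ (y \in W).
  move=> y2 y1; move: (nex y); rewrite in_setD y1 y2 /= => nb.
  have cAy : #|y |: B1 :\ x| = 6.
    by rewrite cardsU1 cA inE (negPf y1) andbF.
  have sAy : y |: B1 :\ x \subset E.
    by rewrite subUset sub1set (subsetP s2).
  have [/existsP[W' /andP[SW' sW']]|/existsPn noW] :=
    boolP [exists W', (W' \in split_blocks) && (y |: B1 :\ x \subset W')].
    move: (SW') sW'; rewrite inE subUset sub1set => /andP[VW' _] /andP[yW' sW'].
    by rewrite (u W').
  case/negP: nb; apply/steiner_basesP; split=> // W' SW'.
  by move: (noW W'); rewrite SW'.
(* [bad] needs at least one point of [B2] outside [B1] to make [W] split. *)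
have sD : B2 :\: B1 != set0.
  rewrite setD_eq0; apply/negP => s21; move: xB2.
  have /eqP -> : B2 == B1 by rewrite eqEcard s21 c1 c2.
  by rewrite xB1.
have [y] := set0Pn _ sD; rewrite inE => /andP[y1 y2].
have [SW _] := bad y y2 y1.
case/negP: (h2 W SW); apply/subsetP => z z2.
have [z1|z1] := boolP (z \in B1); last by have [] := bad z z2 z1.
(* A common point of [B1] and [B2] differs from [x], so it is among the five points defining [W]. *)
apply: (subsetP sAW); rewrite !inE z1 andbT.
by apply: contra xB2 => /eqP <-.
Qed.

Lemma steiner_rank : rank M = 6.
Proof.
have [B BM] := steiner_bases_neq0; apply/eqP; rewrite eqn_leq.
apply/andP; split; first by apply/bigmax_leqP => X /steiner_basesP[_ ->].
by have [_ <- _] := steiner_basesP _ BM; apply: (leq_bigmax_cond (F := fun X : {set T} => #|X|)).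
Qed.

Lemma steiner_paving : paving M.
Proof.
by move=> A sA; rewrite steiner_rank => -[cA]; apply: steiner_independent.
Qed.

(** * Numbers of blocks, split blocks and bases *)

Lemma card_blocks_through1 x : x \in E -> #|[set W in V | x \in W]| = 253.
Proof.
move=> xE; have := @steiner_degree _ _ _ _ _ _ stV [set x].
rewrite sub1set cards1 => /(_ xE isT).
rewrite !setId_sub1.
(* The degree is the quotient of C(23, 4) = 8855 by C(7, 4) = 35. *)
have -> : 'C(8 - 1, 5 - 1) = 35 by [].
have -> : 'C(24 - 1, 5 - 1) = 35 * 253 by [].
lia.
Qed.

Lemma card_blocks_through2 : #|[set W in V | (e \in W) && (f \in W)]| = 77.
Proof.
have := @steiner_degree _ _ _ _ _ _ stV [set e; f].
rewrite subUset !sub1set eE fE cards2 ef => /(_ isT isT).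
rewrite !setId_sub2.
have -> : 'C(8 - 2, 5 - 2) = 20 by [].
have -> : 'C(24 - 2, 5 - 2) = 20 * 77 by [].
lia.
Qed.

(** A block through one of the two points is either split or contains both, which leaves 253 -
    77. *)
Lemma card_split_blocks_through :
  #|[set W in split_blocks | e \in W]| = 176 /\
  #|[set W in split_blocks | f \in W]| = 176.
Proof.
have h1 x : x \in [set e; f] -> #|[set W in split_blocks | x \in (W : {set T})]| + 77 = 253.
  move=> xef; have xE : x \in E by move: xef; rewrite !inE => /orP[]/eqP->.
  rewrite -(card_blocks_through1 xE) -card_blocks_through2.
  rewrite -(cardsID [set W : {set T} | (e \in W) && (f \in W)] [set W in V | x \in W]).
  rewrite addnC; congr (_ + _); apply: eq_card => W; rewrite !inE ?card_setI_pair;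
  move: xef; rewrite !inE => /orP[] /eqP ->;
  by case: (W \in V); case: (e \in W); case: (f \in W).
by have := h1 e (set21 _ _); have := h1 f (set22 _ _); lia.
Qed.

Lemma card_split_blocks : #|split_blocks| = 352.
Proof.
have [he hf] := card_split_blocks_through.
rewrite -(cardsID [set W : {set T} | e \in W] split_blocks).
have -> : split_blocks :&: [set W : {set T} | e \in W] = [set W in split_blocks | e \in W].
  by apply/setP => W; rewrite !inE.
have -> : split_blocks :\: [set W : {set T} | e \in W] = [set W in split_blocks | f \in W].
  apply/setP => W; rewrite !inE card_setI_pair.
  by case: (W \in V); case: (e \in W); case: (f \in W).
by rewrite he hf.
Qed.

(** By [steiner_unique] a hexad lies in only one split block, so the hexads through [S] can be
    counted block by block. *)
Lemma card_split_block_hexads (S : {set T}) : #|S| <= 6 ->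
  #|[set X in split_block_hexads E V e f | S \subset X]|
    = #|[set W in split_blocks | S \subset W]| * 'C(8 - #|S|, 6 - #|S|).
Proof.
move=> cS; rewrite [LHS](double_count (Q := [set W in split_blocks | S \subset W])).
  rewrite -sum_nat_const; apply: eq_bigr => W; rewrite inE => /andP[SW sSW].
  move: (SW); rewrite inE => /andP[VW cW].
  rewrite -(steiner_card stV VW) -card_draws_between //; apply: eq_card => X.
  rewrite !inE; case sXW: (X \subset W); rewrite ?andbF ?andbT //=.
  rewrite (subset_trans sXW (steiner_subset stV VW)) /= andbC.
  case: (S \subset X) => //=; case: (_ == 6) => //=.
  by apply/existsP; exists W; rewrite VW cW.
move=> X; rewrite !inE => /andP[/and3P[sX /eqP cX /existsP[W /and3P[VW cW sXW]]] sSX].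
exists W; split.
  by rewrite !inE VW cW (subset_trans sSX).
move=> W'; rewrite !inE => -[/andP[/andP[VW' _] _] sXW'].
by apply: (steiner_unique (A := X) stV); rewrite ?cX.
Qed.

(** The six-subsets of [E] through [S] are either bases or hexads of split blocks. It is used with
    [S] empty, a single point and the pair. *)
Lemma card_steiner_bases (S : {set T}) : S \subset E -> #|S| <= 6 ->
  #|[set X in bases M | S \subset X]|
    + #|[set W in split_blocks | S \subset W]| * 'C(8 - #|S|, 6 - #|S|)
  = 'C(24 - #|S|, 6 - #|S|).
Proof.
move=> sS cS; have [cE _ _] := stV.
rewrite -card_split_block_hexads // -cE -card_draws_between //.
rewrite -[RHS](cardsID (split_block_hexads E V e f)) addnC; congr (_ + _).
  apply: eq_card => X; rewrite !inE.
  by case: (S \subset X); case: (X \subset E); case: (#|X| == 6); rewrite ?andbT ?andbF.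
apply: eq_card => X; rewrite !inE.
by case: (S \subset X); case: (X \subset E); case: (#|X| == 6); rewrite ?andbT ?andbF.
Qed.

(** The factor 77 common to the three counts of bases is kept apart for [natr_ratio_lt] to
    cancel. *)
Lemma card_bases : #|bases M| = 77 * 1620.
Proof.
have := @card_steiner_bases set0 (sub0set _).
rewrite cards0 => /(_ isT).
have -> : [set X in bases M | set0 \subset X] = bases M.
  by apply/setP => X; rewrite inE sub0set andbT.
have -> : [set X in split_blocks | set0 \subset X] = split_blocks.
  by apply/setP => X; rewrite inE sub0set andbT.
rewrite card_split_blocks.
have -> : 'C(8 - 0, 6 - 0) = 28 by [].
have -> : 'C(24 - 0, 6 - 0) = 77 * 1748.
  (* The falling factorial identity gives a linear equation for the binomial, avoiding Pascal's
     recursion. *)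
  rewrite -[LHS]/'C(24, 6); have := bin_ffact 24 6.
  by rewrite !ffactnS ffactn0 !factS fact0; lia.
lia.
Qed.

Lemma card_bases_through1 x : x \in [set e; f] ->
  #|[set X in bases M | x \in X]| = 77 * 389.
Proof.
move=> xef; have xE : x \in E by move: xef; rewrite !inE => /orP[]/eqP->.
have := @card_steiner_bases [set x].
rewrite sub1set cards1 => /(_ xE isT).
rewrite !setId_sub1.
have -> : #|[set W in split_blocks | x \in (W : {set T})]| = 176.
  have [he hf] := card_split_blocks_through.
  by move: xef; rewrite !inE => /orP[]/eqP->.
have -> : 'C(8 - 1, 6 - 1) = 21 by [].
have -> : 'C(24 - 1, 6 - 1) = 77 * 437.
  rewrite -[LHS]/'C(23, 5); have := bin_ffact 23 5.
  by rewrite !ffactnS ffactn0 !factS fact0; lia.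
lia.
Qed.

(** No split block contains both points, so every hexad of [E] through both is a basis: C(22, 4) of
    them. *)
Lemma card_bases_through2 :
  #|[set X in bases M | (e \in X) && (f \in X)]| = 77 * 95.
Proof.
have := @card_steiner_bases [set e; f].
rewrite subUset !sub1set eE fE cards2 ef => /(_ isT isT).
rewrite !setId_sub2.
have -> : [set W in split_blocks | (e \in (W : {set T})) && (f \in W)] = set0.
  apply/setP => W; rewrite !inE card_setI_pair.
  by case: (e \in W); case: (f \in W); rewrite ?andbF.
rewrite cards0 mul0n addn0 => ->.
rewrite -[LHS]/'C(22, 4); have := bin_ffact 22 4.
by rewrite !ffactnS ffactn0 !factS fact0; lia.
Qed.

Lemma steiner_positive_correlation :
  (Pr M (fun X => e \in X)
     < condPr M (fun X => e \in X) (fun X => f \in X))%R.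
Proof.
rewrite /condPr /Pr card_bases card_bases_through2.
rewrite (card_bases_through1 (set21 e f)) (card_bases_through1 (set22 e f)).
by apply: natr_ratio_lt; lia.
Qed.

Lemma steiner_not_balanced : ~ balanced M.
Proof.
move=> /(_ M (minor_refl M)) /(_ e f eE fE ef).
rewrite leNgt steiner_positive_correlation => h; suff: false by [].
(* It remains to see that [f] is not a loop: some basis contains it. *)
apply: h => -[_ nf].
have : 0 < #|[set X in bases M | f \in X]|.
  by rewrite (card_bases_through1 (set22 e f)) muln_gt0.
by case/card_gt0P => X; rewrite inE => /andP[/nf /negP].
Qed.

End SplitBlocks.

(** * Existence of a Steiner system, from the extended binary Golay code *)

(** Each [t]-set lies in at most one block, and [count] makes the average number of blocks over a
    [t]-set equal to one, so no [t]-set is missed. *)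
Lemma packing_steiner (T : finType) (t k n : nat)
    (E : {set T}) (V : {set {set T}}) :
  #|E| = n ->
  (forall W, W \in V -> W \subset E /\ #|W| = k) ->
  (forall A W1 W2 : {set T}, #|A| = t -> W1 \in V -> W2 \in V ->
     A \subset W1 -> A \subset W2 -> W1 = W2) ->
  #|V| * 'C(k, t) = 'C(n, t) -> steiner_system t k n E V.
Proof.
move=> cE blocks packing count; split=> // A sA cA.
pose P := [set A : {set T} | A \subset E & #|A| == t].
pose d (A : {set T}) := #|[set W in V | A \subset W]|.
have sum_d : \sum_(A in P) d A = #|P|.
  rewrite cards_draws cE -count -sum_nat_const /d.
  under eq_bigr => B _.
    rewrite -sum1_card; under eq_bigl => W do rewrite inE.
    over.
  rewrite (exchange_big_dep (mem V)) /=; last by move=> B W _ /andP[].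
  apply: eq_bigr => W VW; have [sW cW] := blocks W VW.
  rewrite -cW -cards_draws -sum1_card; apply: eq_bigl => B; rewrite !inE VW /=.
  case sB: (B \subset W); rewrite ?andbF ?andbT //=.
  by rewrite (subset_trans sB sW).
have d_le1 B : B \in P -> d B <= 1 ?= iff (d B == 1).
  rewrite inE => /andP[_ /eqP cB]; split=> //.
  rewrite leqNgt; apply/negP => /card_gt1P[W1 [W2 []]].
  rewrite !inE => /andP[V1 s1] /andP[V2 s2] /eqP[].
  exact: packing cB _ _ _ _.
(* Equality of the sums forces equality in every term [d B <= 1]. *)
have [_] := leqif_sum d_le1.
rewrite sum_d sum1_card eqxx => /esym/forall_inP d1.
have PA : A \in P by rewrite inE sA cA eqxx.
have /cards1P[W eW] := d1 A PA.
have inW W' : (W' \in V) && (A \subset W') = (W' == W).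
  by rewrite -in_set1 -eW inE.
exists W; split; first by apply/andP; rewrite inW eqxx.
by move=> W' /andP; rewrite inW => /eqP.
Qed.

(* Words of length 24 are the binary digits of numbers below [2 ^ 24]. *)
Definition bits (w : N) : {set 'I_24} :=
  [set i : 'I_24 | N.testbit w (N.of_nat i)].

Definition weight (w : N) : nat :=
  count (fun i => N.testbit w (N.of_nat i)) (iota 0 24).

(** The binary linear code generated by [gs], bitwise xor being addition over the field of two
    elements. *)
Fixpoint xor_span (gs : seq N) : seq N :=
  if gs is g :: gs' then
    let c := xor_span gs' in c ++ [seq N.lxor g w | w <- c]
  else [:: N0].

Lemma xor_span_closed gs :
  {in xor_span gs &, forall u w, N.lxor u w \in xor_span gs}.
Proof.
elim: gs => [|g gs IH] u w /=.
  by rewrite !inE => /eqP-> /eqP->.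
rewrite !mem_cat => /orP[ux|/mapP[u' ux ->]] /orP[wx|/mapP[w' wx ->]].
- by rewrite IH.
- apply/orP; right; apply/mapP; exists (N.lxor u w'); first exact: IH.
  by rewrite -!N.lxor_assoc (N.lxor_comm u).
- apply/orP; right; apply/mapP; exists (N.lxor u' w); first exact: IH.
  by rewrite N.lxor_assoc.
- have -> : N.lxor (N.lxor g u') (N.lxor g w') = N.lxor u' w'.
    by rewrite (N.lxor_comm g u') N.lxor_assoc -(N.lxor_assoc g g) N.lxor_nilpotent N.lxor_0_l.
  by rewrite IH.
Qed.

(* 3189 encodes the generator polynomial
   [x^11 + x^10 + x^6 + x^5 + x^4 + x^2 + 1] of the perfect binary Golay code of
   length 23; bit 23 is the parity check, equal to 1 on each of the 12 shifts
   because this polynomial has seven terms. *)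
Definition golay_generators : seq N :=
  [seq N.add (N.shiftl 3189 (N.of_nat i)) 8388608 | i <- iota 0 12].

Definition golay_code : seq N := xor_span golay_generators.

Definition octads : seq N := [seq w <- golay_code | weight w == 8].

(** Verified by evaluation on all 4096 words. By linearity it also bounds the distance between
    distinct codewords. *)
Lemma golay_min_weight w : w \in golay_code -> w = N0 \/ 8 <= weight w.
Proof.
have : all (fun w => (w == N0) || (8 <= weight w)) golay_code by vm_compute.
by move/allP => h /h /orP[/eqP|]; [left | right].
Qed.

Lemma size_octads : size octads = 759.
Proof. by vm_compute. Qed.

Lemma octads_uniq : uniq octads.
Proof. by vm_compute. Qed.

Lemma card_bits w : #|bits w| = weight w.
Proof.
by rewrite cardsE cardE /enum_mem size_filter -enumT /weight -val_enum_ord count_map.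
Qed.

Lemma bits_lxor u w :
  bits (N.lxor u w) = (bits u :\: bits w) :|: (bits w :\: bits u).
Proof.
apply/setP => i; rewrite !inE N.lxor_spec.
by case: (N.testbit u _); case: (N.testbit w _).
Qed.

Lemma mem_octads w : w \in octads -> w \in golay_code /\ #|bits w| = 8.
Proof. by rewrite mem_filter card_bits => /andP[/eqP]. Qed.

(** The sum of two distinct octads is a nonzero codeword of weight 16 - 2m, where m is the size of
    the intersection, and this weight is at least 8. *)
Lemma octads_meet u w : u \in octads -> w \in octads -> u != w ->
  #|bits u :&: bits w| <= 4.
Proof.
move=> /mem_octads[cu wu] /mem_octads[cw ww] uw.
have /golay_min_weight [/N.lxor_eq e|] := xor_span_closed cu cw.
  by rewrite e eqxx in uw.
rewrite -card_bits bits_lxor => h.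
have := leq_trans h (leq_card_setU _ _).
have := cardsID (bits w) (bits u); have := cardsID (bits u) (bits w).
rewrite setIC; lia.
Qed.

(** Distinct octads with equal supports would meet in eight points, more than four. *)
Lemma bits_inj : {in octads &, injective bits}.
Proof.
move=> u w ou ow eq_uw; apply/eqP/negPn/negP => /(octads_meet ou ow).
by rewrite eq_uw setIid; have [_ ->] := mem_octads ow.
Qed.

Definition golay_octads : {set {set 'I_24}} := [set W in map bits octads].

Lemma card_golay_octads : #|golay_octads| = 759.
Proof.
rewrite cardsE -size_octads -(size_map bits); apply/card_uniqP.
by rewrite map_inj_in_uniq ?octads_uniq //; apply: bits_inj.
Qed.

Lemma golay_octadsP W :
  W \in golay_octads -> exists2 w, w \in octads & W = bits w.
Proof. by rewrite inE => /mapP. Qed.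

Lemma golay_octads_unique (A W1 W2 : {set 'I_24}) : #|A| = 5 ->
  W1 \in golay_octads -> W2 \in golay_octads ->
  A \subset W1 -> A \subset W2 -> W1 = W2.
Proof.
move=> cA /golay_octadsP[u ou ->] /golay_octadsP[w ow ->] Au Aw.
have [-> //|/(octads_meet ou ow) le4] := eqVneq u w.
have : A \subset bits u :&: bits w by rewrite subsetI Au.
by move/subset_leq_card; rewrite cA leqNgt ltnS le4.
Qed.

Lemma golay_steiner : steiner_system 5 8 24 [set: 'I_24] golay_octads.
Proof.
apply: packing_steiner.
- by rewrite cardsT card_ord.
- by move=> W /golay_octadsP[w /mem_octads[_ cw] ->]; rewrite subsetT.
- exact: golay_octads_unique.
- rewrite card_golay_octads; have := bin_ffact 24 5.
  by rewrite (_ : 'C(8, 5) = 56) // !ffactnS ffactn0 !factS fact0; lia.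
Qed.

Theorem mainTheorem2 :
  (forall (T : finType) (E : {set T}) (V : {set {set T}}) (e f : T),
     steiner_system 5 8 24 E V -> e \in E -> f \in E -> e != f ->
     let M := steiner_basis_system E V e f in
     [/\ is_matroid M /\ paving M,
         rank M = 6 /\ #|ground M| = 24,
         (condPr M (fun X => e \in X) (fun X => f \in X)
            > Pr M (fun X => e \in X))%R
       & ~ balanced M])
  /\ (exists (T : finType) (M : basis_system T),
        [/\ is_matroid M, paving M & ~ balanced M]).
Proof.
have main (T : finType) (E : {set T}) (V : {set {set T}}) (e f : T) :
    steiner_system 5 8 24 E V -> e \in E -> f \in E -> e != f ->
    let M := steiner_basis_system E V e f in
    [/\ is_matroid M /\ paving M,
        rank M = 6 /\ #|ground M| = 24,
        (condPr M (fun X => e \in X) (fun X => f \in X)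
           > Pr M (fun X => e \in X))%R
      & ~ balanced M].
  move=> stV eE fE ef M; have [cE _ _] := stV; split.
  - by split; [apply: steiner_is_matroid | apply: steiner_paving].
  - by split; [apply: steiner_rank |].
  - exact: steiner_positive_correlation.
  - exact: steiner_not_balanced.
split; first exact: main.
have ne0 : ord0 != ord_max :> 'I_24 by [].
have [[mM pM] _ _ nb] := main _ _ _ _ _ golay_steiner (in_setT _) (in_setT _) ne0.
by exists 'I_24, (steiner_basis_system [set: 'I_24] golay_octads ord0 ord_max).
Qed.
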